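(* Let $k$ be a field, $n\ge1$ and $R:=k[t_1^{\pm},\ldots,t_n^{\pm}]$ the Laurent polynomial ring. For all $f_0,\ldots,f_n\in R$, $$\operatorname{res}_{t_1}\cdots\operatorname{res}_{t_n}f_0\,\mathrm{d}f_1\ldots\mathrm{d}f_n=(-1)^n\operatorname{tr}\sum_{\pi\in\mathfrak{S}_n}\operatorname{sgn}(\pi)\sum_{\gamma_1,\ldots,\gamma_n\in\{\pm\}}(-1)^{\gamma_1+\cdots+\gamma_n}\big(P_1^{-\gamma_1}\operatorname{ad}(f_{\pi(1)})P_1^{\gamma_1}\big)\cdots\big(P_n^{-\gamma_n}\operatorname{ad}(f_{\pi(n)})P_n^{\gamma_n}\big)f_0,$$ where $P_1^{\pm},\ldots,P_n^{\pm}$ are the projectors on $R$ defined in the context. Moreover: (1) For $n=1$ and $\pi:=P_1^+$ the formula reduces to $\operatorname{res}f_0\,\mathrm{d}f_1=\operatorname{tr}([\pi,f_1]f_0)$. (2) If $f_i=t_1^{c_{i,1}}\cdots t_n^{c_{i,n}}$ with $c_{i,j}\in\mathbf{Z}$ for $i=0,\ldots,n$, the formula reduces to $$\operatorname{res}f_0\,\mathrm{d}f_1\ldots\mathrm{d}f_n=\det\begin{pmatrix}c_{1,1}&\cdots&c_{n,1}\\\vdots&\ddots&\vdots\\c_{1,n}&\cdots&c_{n,n}\end{pmatrix}\qquad\text{if }\ \sum_{p=0}^nc_{p,i}=0\ \text{ for all } i\in\{1,\ldots,n\},$$ and the residue is zero if the condition is not satisfied. (3) For $n=1$ and $f_1=t_1$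 this reduces by linearity to the classical definition: for $\alpha\in k$ and $c_1\in\mathbf{Z}$, $\operatorname{res}\alpha t_1^{c_1}\mathrm{d}t_1=\alpha$ if $c_1=-1$ and $0$ if $c_1\ne-1$.
   Context: $\operatorname{res}=\operatorname{res}_{t_1}\cdots\operatorname{res}_{t_n}$ of an $n$-form $h\,\mathrm{d}t_1\wedge\cdots\wedge\mathrm{d}t_n$, $h\in R$, is the coefficient of $t_1^{-1}\cdots t_n^{-1}$ in $h$; $f_0\mathrm{d}f_1\ldots\mathrm{d}f_n$ means $f_0\,\mathrm{d}f_1\wedge\cdots\wedge\mathrm{d}f_n\in\Omega^n_{R/k}$. On the right-hand side, elements $f\in R$ are read as the multiplication operators $x\mapsto f\cdot x$ on the $k$-vector space $k[\mathbf{t}_1^{\pm},\ldots,\mathbf{t}_n^{\pm}]$ (the underlying space of $R$; bold letters denote basis vectors). The projectors are $P_j^+\mathbf{t}_1^{\lambda_1}\cdots\mathbf{t}_n^{\lambda_n}=\mathbf{t}_1^{\lambda_1}\cdots\mathbf{t}_n^{\lambda_n}$ if $\lambda_j\ge0$ and $0$ otherwise, and $P_j^-=1-P_j^+$. The operators $P_j^{\gamma}$ act on endomorphisms by left composition, $\operatorname{ad}(f)g=fg-gf$, so the product of brackets is applied to the endomorphism $f_0$. $(-1)^{\pm}=\pm1$. $\operatorname{tr}$ is the trace of an endomorphism whose matrix in the monomial basis has only finitely many nonzero entries. Integers are read in $k$. *)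

(* Defs.v *)
From HB Require Import structures.
From mathcomp Require Import all_boot all_order all_fingroup all_algebra.
From mathcomp Require Import boolp classical_sets functions cardinality fsbigop.
From mathcomp Require Import finmap.
From mathcomp.multinomials Require Import monalg.

Set Implicit Arguments.
Unset Strict Implicit.
Unset Printing Implicit Defensive.

Import Order.TTheory GRing.Theory Num.Theory.
Local Open Scope ring_scope.

(* Laurent polynomials are the group algebra of Z^n.  The product provided on
   {malg R[M]} asks for a monoid M without nontrivial invertible elements, so
   the convolution product is defined here, on an alias of {malg k[Z^n]}. *)

Definition expo (n : nat) := {ffun 'I_n -> int}.
HB.instance Definition _ n := GRing.Zmodule.on (expo n).

Definition laurent (k : fieldType) (n : nat) := {malg k[expo n]}.

HB.lock Definition lmul (k : fieldType) (n : nat) (f g : laurent k n) :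
    laurent k n :=
  \sum_(a <- msupp f) \sum_(b <- msupp g) << f@_a * g@_b *g (a + b) >>.
Canonical lmul_unlockable := Unlockable lmul.unlock.

Section LaurentRing.
Variables (k : fieldType) (n : nat).
Local Notation R := (laurent k n).
Implicit Types (f g h : R) (a b : expo n) (c : k).
Local Notation lmul := (@lmul k n).

HB.instance Definition _ := GRing.Lmodule.on R.

Definition monomial a : R := << 1 *g a >>.

Lemma lmulw (A B : {fset expo n}) f g :
  (msupp f `<=` A)%fset -> (msupp g `<=` B)%fset ->
  lmul f g = \sum_(a <- A) \sum_(b <- B) << f@_a * g@_b *g (a + b) >>.
Proof.
move=> sA sB; rewrite unlock (big_fset_incl _ sA) /=.
  apply/eq_bigr=> a _; apply/big_fset_incl => // b _ /mcoeff_outdom ->.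
  by rewrite mulr0 monalgU0.
move=> a _ /mcoeff_outdom fa.
by rewrite big1 // => b _; rewrite fa mul0r monalgU0.
Qed.

Lemma lmulC : commutative lmul.
Proof.
move=> f g; rewrite unlock exchange_big; apply/eq_bigr=> b _.
by apply/eq_bigr=> a _; rewrite mulrC addrC.
Qed.

Lemma lmulDl : left_distributive lmul +%R.
Proof.
move=> f g h; set A := (msupp f `|` msupp g)%fset.
rewrite (@lmulw A (msupp h) f) ?fsubsetUl ?fsubset_refl //.
rewrite (@lmulw A (msupp h) g) ?fsubsetUr ?fsubset_refl //.
rewrite (@lmulw A (msupp h) (f + g)) ?msuppD_le ?fsubset_refl //.
rewrite -big_split /=; apply/eq_bigr=> a _.
rewrite -big_split /=; apply/eq_bigr=> b _.
by rewrite mcoeffD mulrDl monalgUD.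
Qed.

Lemma lmul0 : left_zero 0 lmul.
Proof. by move=> f; rewrite unlock msupp0 big_seq_fset0. Qed.

Lemma lmulUU c c' a b :
  lmul << c *g a >> << c' *g b >> = << c * c' *g a + b >>.
Proof.
by rewrite (lmulw msuppU_le msuppU_le) !big_seq_fset1 !mcoeffUU.
Qed.

Lemma lmul_suml (I : Type) (r : seq I) (F : I -> R) g :
  lmul (\sum_(i <- r) F i) g = \sum_(i <- r) lmul (F i) g.
Proof.
by rewrite (big_morph (lmul^~ g) (fun _ _ => lmulDl _ _ _) (lmul0 g)).
Qed.

Lemma lmul_sumr (I : Type) (r : seq I) (F : I -> R) f :
  lmul f (\sum_(i <- r) F i) = \sum_(i <- r) lmul f (F i).
Proof.
by rewrite lmulC lmul_suml; apply/eq_bigr => i _; rewrite lmulC.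
Qed.

Lemma lmulA : associative lmul.
Proof.
move=> f g h; move: lmul lmul_suml lmul_sumr lmulUU => m mDl mDr mUU.
rewrite (monalgE f) !mDl; apply: eq_bigr => a _.
rewrite (monalgE g) mDl !mDr mDl; apply: eq_bigr => b _.
rewrite (monalgE h) !mDr; apply: eq_bigr => c _.
by rewrite !mUU mulrA addrA.
Qed.

Lemma lmul1 : left_id (monomial 0) lmul.
Proof.
move=> f; rewrite [in RHS](monalgE f) [in LHS](monalgE f) lmul_sumr.
by apply/eq_bigr=> a _; rewrite lmulUU mul1r add0r.
Qed.

Lemma lone_neq0 : monomial 0 != 0.
Proof. by rewrite monalgU_eq0 oner_eq0. Qed.

HB.instance Definition _ := GRing.Zmodule_isComNzRing.Build R
  lmulA lmulC lmul1 lmulDl lone_neq0.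

Lemma lscaleAl c f g : c *: (f * g) = (c *: f) * g.
Proof.
have sZ a c' : c *: (<< c' *g a >> : R) = << c * c' *g a >>.
  by apply/malgP=> d; rewrite mcoeffZ !mcoeffU mulrnAr.
change (c *: lmul f g = lmul (c *: f) g).
rewrite {1}lmul.unlock (lmulw (msuppZ_le _ _) (fsubset_refl _)) scaler_sumr.
apply/eq_bigr=> a _; rewrite scaler_sumr; apply/eq_bigr=> b _.
by rewrite sZ mcoeffZ mulrA.
Qed.

HB.instance Definition _ := GRing.Lmodule_isLalgebra.Build k R lscaleAl.
HB.instance Definition _ := GRing.Lalgebra_isComAlgebra.Build k R.

End LaurentRing.

Definition var (k : fieldType) (n : nat) (i : 'I_n) : laurent k n :=
  monomial k [ffun j => (j == i)%:Z].

Section ModuleQuotient.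
Variables (A : comNzRingType) (V : lmodType A) (gen : V -> Prop).

Definition in_span (v : V) : bool :=
  `[< forall S : {pred V}, GRing.submod_closed S ->
      (forall r, gen r -> r \in S) -> v \in S >].

Lemma in_span_submod : GRing.submod_closed in_span.
Proof.
split=> [|a u v /asboolP su /asboolP sv]; apply/asboolP => S cS rS.
  by case: cS.
by case: (cS) => _; apply; [apply: su|apply: sv].
Qed.

HB.instance Definition _ :=
  GRing.isSubmodClosed.Build A V in_span in_span_submod.

Definition mod_quot := Quotient.quot (GRing.ZmodClosed.clone V in_span _).
HB.instance Definition _ := GRing.Zmodule.on mod_quot.

End ModuleQuotient.

HB.lock Definition mod_class (A : comNzRingType) (V : lmodType A)
    (gen : V -> Prop) (v : V) : mod_quot gen :=
  \pi_(mod_quot gen)%qT v.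

HB.lock Definition qscale (A : comNzRingType) (V : lmodType A)
    (gen : V -> Prop) (a : A) (x : mod_quot gen) : mod_quot gen :=
  mod_class gen (a *: generic_quotient.repr x).

Section ModuleQuotientTheory.
Variables (A : comNzRingType) (V : lmodType A) (gen : V -> Prop).
Local Notation in_span := (in_span gen).
Local Notation mod_quot := (mod_quot gen).
Local Notation mod_class := (mod_class gen).
Local Notation qscale := (@qscale A V gen).
Implicit Types (x y : mod_quot) (u v : V) (a b : A).

Lemma mod_classK : cancel (generic_quotient.repr : mod_quot -> V) mod_class.
Proof. by move=> x; rewrite mod_class.unlock; exact: reprK. Qed.

Lemma mod_classD : {morph mod_class : u v / u + v}.
Proof. by rewrite mod_class.unlock; exact: Quotient.pi_add. Qed.

Lemma mod_classP u v : (mod_class u = mod_class v) <-> in_span (u - v).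
Proof.
rewrite mod_class.unlock.
by split=> [/eqP|h]; [|apply/eqP]; rewrite -[_ == _]Quotient.idealrBE.
Qed.

Lemma mod_class_qscale a v : mod_class (a *: v) = qscale a (mod_class v).
Proof.
rewrite qscale.unlock; apply/mod_classP; rewrite -scalerBr.
apply: (@rpredZ A V (GRing.SubmodClosed.clone A V in_span _)).
by apply/mod_classP; rewrite mod_classK.
Qed.

Lemma qscaleA a b x : qscale a (qscale b x) = qscale (a * b) x.
Proof. by rewrite -[x]mod_classK -!mod_class_qscale scalerA. Qed.

Lemma qscale1 : left_id 1 qscale.
Proof. by move=> x; rewrite -[x]mod_classK -mod_class_qscale scale1r. Qed.

Lemma qscaleDr : right_distributive qscale +%R.
Proof.
move=> a x y; rewrite -[x]mod_classK -[y]mod_classK -mod_classD.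
by rewrite -!mod_class_qscale scalerDr mod_classD.
Qed.

Lemma qscaleDl x : {morph qscale^~ x : a b / a + b}.
Proof.
move=> a b; rewrite -[x]mod_classK -!mod_class_qscale.
by rewrite scalerDl mod_classD.
Qed.

HB.instance Definition _ := GRing.Zmodule_isLmodule.Build A mod_quot
  qscaleA qscale1 qscaleDr qscaleDl.

Lemma mod_class_linear : linear mod_class.
Proof. by move=> a u v; rewrite mod_classD mod_class_qscale. Qed.

HB.instance Definition _ :=
  GRing.isLinear.Build A V mod_quot *:%R mod_class mod_class_linear.

Lemma mod_classZ a v : mod_class (a *: v) = a *: mod_class v.
Proof. exact: mod_class_qscale. Qed.

Lemma mod_class_gen v : gen v -> mod_class v = 0.
Proof.
rewrite -[RHS](linear0 mod_class) => gv; apply/mod_classP; rewrite subr0.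
by apply/asboolP => S _; apply.
Qed.

End ModuleQuotientTheory.

(* The basis vector x of the free module {malg A[X]}, locked so that
   unification does not unfold it. *)
HB.lock Definition fgen (A : comNzRingType) (X : choiceType) (x : X) :
    {malg A[X]} := << x >>.
Arguments fgen {A X} x.

(* Omega_{A/K}: the free A-module on symbols fgen x, x in A, modulo
   the relations making x |-> fgen x a K-linear derivation. *)
Section Kaehler.
Variables (K : comNzRingType) (A : comAlgType K).

Variant kaehler_rel : {malg A[A]} -> Prop :=
| KaehlerD x y : kaehler_rel (fgen (x + y) - fgen x - fgen y)
| KaehlerZ (c : K) x : kaehler_rel (fgen (c *: x) - c%:A *: fgen x)
| KaehlerM x y : kaehler_rel (fgen (x * y) - x *: fgen y - y *: fgen x).

Definition kaehler := mod_quot kaehler_rel.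
HB.instance Definition _ := GRing.Lmodule.on kaehler.

End Kaehler.

HB.lock Definition kd (K : comNzRingType) (A : comAlgType K) (x : A) :
    kaehler A :=
  mod_class (@kaehler_rel K A) (fgen x).

(* The p-th exterior power of M over A, with wedge m = m_1 /\ ... /\ m_p. *)
Section ExteriorPower.
Variables (A : comNzRingType) (M : lmodType A) (p : nat).

Definition slot (m : {ffun 'I_p -> M}) (i : 'I_p) (x : M) : {ffun 'I_p -> M} :=
  [ffun j => if j == i then x else m j].

Variant ext_rel : {malg A[{ffun 'I_p -> M}]} -> Prop :=
| ExtD m i x y :
    ext_rel (fgen (slot m i (x + y)) - fgen (slot m i x) - fgen (slot m i y))
| ExtZ m i a x : ext_rel (fgen (slot m i (a *: x)) - a *: fgen (slot m i x))
| ExtAlt (m : {ffun 'I_p -> M}) i j :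
    i != j -> m i = m j -> ext_rel (fgen m).

Definition ext := mod_quot ext_rel.
HB.instance Definition _ := GRing.Lmodule.on ext.

End ExteriorPower.

HB.lock Definition wedge (A : comNzRingType) (M : lmodType A) (p : nat)
    (m : {ffun 'I_p -> M}) : ext M p :=
  mod_class (@ext_rel A M p) (fgen m).

Section Residue.
Variables (k : fieldType) (n : nat).
Local Notation R := (laurent k n).

Definition forms := ext (kaehler R) n.
HB.instance Definition _ := GRing.Lmodule.on forms.

Definition diff_form (f0 : R) (f : 'I_n -> R) : forms :=
  f0 *: wedge [ffun i => kd (f i)].

Definition vol : forms := wedge [ffun i => kd (var k i)].

(* Omega^n is free of rank 1 on vol = dt_1 /\ ... /\ dt_n, so every n-form is
   h *: vol for exactly one h and the default value of xget is never used. *)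
Definition top_coef (w : forms) : R :=
  xget 0 [set h | w = h *: vol]%classic.

Definition res (w : forms) : k := (top_coef w)@_[ffun=> -1].

End Residue.

Section Operators.
Variables (k : fieldType) (n : nat).
Local Notation R := (laurent k n).

Definition mulop (f x : R) : R := f * x.

Definition ad (f : R) (g : R -> R) : R -> R := (mulop f \o g) - (g \o mulop f).

Definition pplus (j : 'I_n) (x : R) : R :=
  \sum_(a <- msupp x | 0 <= a j) x@_a *: monomial k a.

(* Signs are booleans: true is + and false is -. *)
Definition proj (j : 'I_n) (s : bool) : R -> R :=
  if s then pplus j else fun x => x - pplus j x.

(* The operator P_j^{-s} ad(f) P_j^s on endomorphisms: the projectors act by
   composition on the left. *)
Definition bracket (j : 'I_n) (s : bool) (f : R) (g : R -> R) : R -> R :=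
  proj j (~~ s) \o ad f (proj j s \o g).

Definition res_op (f0 : R) (f : 'I_n -> R) : R -> R :=
  \sum_(pi : 'S_n) \sum_(s : {ffun 'I_n -> bool})
    ((-1) ^+ pi * \prod_j (if s j then 1 else -1) : k) *:
    (\big[comp/id]_(j < n) bracket j (s j) (f (pi j))) (mulop f0).

Definition finite_matrix (phi : R -> R) : Prop :=
  linear phi /\
  finite_set
    [set ab : expo n * expo n | (phi (monomial k ab.1))@_(ab.2) != 0]%classic.

(* Finite-support sum of the diagonal entries; meaningful when phi satisfies
   finite_matrix. *)
Definition tr (phi : R -> R) : k :=
  \sum_(a \in [set: expo n]%classic) (phi (monomial k a))@_a.

End Operators.

(* Main.v *)
From HB Require Import structures.
Require Import Defs.
From mathcomp Require Import all_boot all_order all_fingroup all_algebra.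
From mathcomp Require Import boolp classical_sets functions cardinality fsbigop.
From mathcomp Require Import finmap.
From mathcomp.multinomials Require Import monalg.
From mathcomp Require Import zify.

Set Implicit Arguments.
Unset Strict Implicit.
Unset Printing Implicit Defensive.

Import Order.TTheory GRing.Theory Num.Theory.
Local Open Scope ring_scope.

(** Both sides are compared with one explicit number, the constant coefficient
    of f0 * det (D_j f_i), where D_j = t_j d/dt_j is the logarithmic derivation
    t^a |-> a_j t^a.

    Residue side.  In the module of Kaehler differentials every f satisfies
    df = sum_j D_j f * dlog t_j, since both sides are linear in f and agree on
    monomials (kd_logder).  Expanding the wedge product turns
    f0 df_1 /\ ... /\ df_n into f0 det (D_j f_i) times
    dlog t_1 /\ ... /\ dlog t_n, and vol = t_1 ... t_n times the latter
    (wedge_kd).  The coefficient on vol is well determined because a linear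
    functional on n-forms takes f0 df_1 /\ ... /\ df_n to f0 det (D_j f_i)
    (jac_functional); its value on vol is the unit t_1 ... t_n.  Taking the
    coefficient of (t_1 ... t_n)^-1 gives res_jac.

    Trace side.  As P_j^{-s} P_j^s = 0, the operator P_j^{-s} ad(f) P_j^s is
    just P_j^{-s} f P_j^s (bracketE), so res_op is linear in each f_i.
    It is thus enough to treat monomials f_i = t^{c_i} (multilinear_span_ind).
    There the operator sends t^a to a multiple of t^{a + c_0 + ... + c_n}.  Once
    the signs are summed, the scalar is a signed sum over permutations pi of
    products over j of jumps [v >= 0] - [v + d >= 0], with d = c_{pi j, j} and v a
    translate of a_j (res_op_mon).  A jump vanishes far from the origin, so the
    operator is finite, and the jumps add up to -d over all translates
    (sum_jump).  The trace is therefore (-1)^n times the Leibniz expansion of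
    det (c_{i, j}) when the exponents cancel, and 0 otherwise
    (finite_trace_mon).

    The special cases are read off from the determinant, except the case n = 1
    of the operator, where P^- f P^+ - P^+ f P^- = - [P^+, f]
    (comm_pplusE). *)

(** * Induction on spans, multilinearity and determinants *)

Lemma in_span_ind (A : comNzRingType) (V : lmodType A) (gen : V -> Prop)
    (P : V -> Prop) :
  P 0 -> (forall a u v, P u -> P v -> P (a *: u + v)) ->
  (forall v, gen v -> P v) -> forall v, in_span gen v -> P v.
Proof.
move=> P0 PZD Pgen v /asboolP spv; apply/asboolP.
apply: (spv (fun v => `[< P v >])) => [|u /Pgen Pu]; last exact/asboolP.
split=> [|a u w /asboolP Pu /asboolP Pw]; apply/asboolP => //; exact: PZD.
Qed.

Lemma slot_id (A : comNzRingType) (M : lmodType A) (p : nat)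
    (m : {ffun 'I_p -> M}) i : slot m i (m i) = m.
Proof. by apply/ffunP=> j; rewrite ffunE; case: eqP => [->|]. Qed.

(** Slots are treated one after another: the induction is on the number of
    slots that are not yet known to hold a generator. *)
Lemma multilinear_span_ind (A : comNzRingType) (M : lmodType A) (p : nat)
    (gen : M -> Prop) (Q : {ffun 'I_p -> M} -> Prop) :
  (forall m i, Q (slot m i 0)) ->
  (forall m i a x y, Q (slot m i x) -> Q (slot m i y) ->
    Q (slot m i (a *: x + y))) ->
  (forall m : {ffun 'I_p -> M}, (forall i, gen (m i)) -> Q m) ->
  forall m : {ffun 'I_p -> M}, (forall i, in_span gen (m i)) -> Q m.
Proof.
move=> Q0 QZD Qgen m spm.
suff: forall q : nat, forall m : {ffun 'I_p -> M},
    (forall i : 'I_p, (i < q)%N -> in_span gen (m i)) ->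
    (forall i : 'I_p, (q <= i)%N -> gen (m i)) -> Q m.
  by move=> /(_ p); apply=> [i _|i]; [exact: spm | rewrite leqNgt ltn_ord].
elim=> [|q IHq] {spm}m spm gm; first by apply: Qgen => i; exact: gm.
have [lt_qp|le_pq] := ltnP q p; last first.
  apply: IHq => i lti; first by apply: spm; exact: leqW.
  by move: (leq_trans le_pq lti); rewrite leqNgt ltn_ord.
pose i0 := Ordinal lt_qp.
have /(in_span_ind (P := fun v => Q (slot m i0 v))) H : in_span gen (m i0).
  exact: spm.
rewrite -(slot_id m i0); apply: H => [|a u v|v gv]; [exact: Q0|exact: QZD|].
apply: IHq => i; rewrite ffunE -val_eqE /=.
  by move=> lti; rewrite ltn_eqF //; apply: spm; exact: leqW.
rewrite leq_eqVlt eq_sym => /orP[->//|lti].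
by case: eqP => // _; exact: gm.
Qed.

Lemma det_slot (A : comNzRingType) (p : nat) (m : {ffun 'I_p -> 'rV[A]_p})
    i a x y :
  \det (\matrix_l slot m i (a *: x + y) l) =
    a * \det (\matrix_l slot m i x l) + \det (\matrix_l slot m i y l).
Proof.
rewrite -[X in _ = _ + X]mul1r; apply: (@determinant_multilinear _ _ _ _ _ i).
- by rewrite !rowK !ffunE eqxx scale1r.
- by apply/matrixP=> l j; rewrite !mxE !ffunE eq_sym (negPf (neq_lift _ _)).
- by apply/matrixP=> l j; rewrite !mxE !ffunE eq_sym (negPf (neq_lift _ _)).
Qed.

Lemma det_slot0 (A : comNzRingType) (p : nat) (m : {ffun 'I_p -> 'rV[A]_p}) i :
  \det (\matrix_l slot m i 0 l) = 0.
Proof. by rewrite -[0 in LHS](addNr 0) -scaleN1r det_slot mulN1r addNr. Qed.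

(** * Universal properties of differentials and exterior powers *)

Lemma mod_quot_lift (A : comNzRingType) (V N : lmodType A) (gen : V -> Prop)
    (F : {linear V -> N}) :
  (forall r, gen r -> F r = 0) ->
  {G : {linear mod_quot gen -> N} | forall v, G (mod_class gen v) = F v}.
Proof.
move=> Fgen.
pose g (x : mod_quot gen) := F (generic_quotient.repr x).
have gE v : g (mod_class gen v) = F v.
  apply/eqP; rewrite -subr_eq0 -raddfB; apply/eqP.
  apply: (in_span_ind (P := fun v => F v = 0)) Fgen _ _ => [|a x y Fx Fy|].
  - exact: raddf0.
  - by rewrite linearP Fx Fy scaler0 addr0.
  - by apply/mod_classP; rewrite mod_classK.
have glin : linear g.
  move=> a x y; rewrite -[x]mod_classK -[y]mod_classK -linearP !gE.
  exact: linearP.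
pose G : {linear mod_quot gen -> N} :=
  HB.pack g (GRing.isLinear.Build _ _ _ _ g glin).
by exists G.
Qed.

Lemma malg_lift (A : comNzRingType) (X : choiceType) (N : lmodType A)
    (h : X -> N) :
  {F : {linear {malg A[X]} -> N} | forall a x, F << a *g x >> = a *: h x}.
Proof.
pose F (g : {malg A[X]}) := \sum_(x <- msupp g) g@_x *: h x.
have Fw (B : {fset X}) g : (msupp g `<=` B)%fset ->
    F g = \sum_(x <- B) g@_x *: h x.
  move=> sB; rewrite /F (big_fset_incl _ sB) //= => x _ /mcoeff_outdom ->.
  exact: scale0r.
have Flin : linear F.
  move=> a u v; set B := (msupp u `|` msupp v)%fset.
  rewrite (Fw B u) ?fsubsetUl // (Fw B v) ?fsubsetUr // (Fw B); last first.
    apply: fsubset_trans (msuppD_le _ _) _.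
    by apply: fsetSU; exact: msuppZ_le.
  rewrite scaler_sumr -big_split; apply: eq_bigr => x _ /=.
  by rewrite mcoeffD mcoeffZ scalerDl scalerA.
pose G : {linear {malg A[X]} -> N} :=
  HB.pack F (GRing.isLinear.Build _ _ _ _ F Flin).
exists G => a x; rewrite /G /= (Fw [fset x]%fset) ?msuppU_le //.
by rewrite big_seq_fset1 mcoeffUU.
Qed.

Lemma fgen_lift (A : comNzRingType) (X : choiceType) (N : lmodType A)
    (h : X -> N) :
  {F : {linear {malg A[X]} -> N} | forall x, F (fgen x) = h x}.
Proof.
have [F FE] := malg_lift h; exists F => x.
by rewrite fgen.unlock FE scale1r.
Qed.

(** Universal property of Kaehler differentials: derivations factor through
    kd. *)
Lemma kaehler_lift (K : comNzRingType) (A : comAlgType K) (N : lmodType A)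
    (D : A -> N) :
  (forall x y, D (x + y) = D x + D y) ->
  (forall (c : K) x, D (c *: x) = (c%:A : A) *: D x) ->
  (forall x y, D (x * y) = x *: D y + y *: D x) ->
  {F : {linear kaehler A -> N} | forall x, F (kd x) = D x}.
Proof.
move=> DD DZ DM; have [E EE] := fgen_lift D.
have E0 r : kaehler_rel r -> E r = 0.
  case=> [x y|c x|x y]; rewrite !raddfB /= ?linearZ /= !EE.
  - by rewrite DD addrAC addrK subrr.
  - by rewrite DZ scalerN subrr.
  - by rewrite DM !scalerN addrAC addrK subrr.
have [F FE] := mod_quot_lift E0; exists F => x.
by rewrite kd.unlock FE EE.
Qed.

(** Universal property of the exterior power. *)
Lemma ext_lift (A : comNzRingType) (M N : lmodType A) (p : nat)
    (h : {ffun 'I_p -> M} -> N) :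
  (forall m i a x y,
    h (slot m i (a *: x + y)) = a *: h (slot m i x) + h (slot m i y)) ->
  (forall (m : {ffun 'I_p -> M}) i j, i != j -> m i = m j -> h m = 0) ->
  {F : {linear ext M p -> N} | forall m, F (wedge m) = h m}.
Proof.
move=> hP halt; have [E EE] := fgen_lift h.
have hD m i x y : h (slot m i (x + y)) = h (slot m i x) + h (slot m i y).
  by have := hP m i 1 x y; rewrite !scale1r.
have h0 m i : h (slot m i 0) = 0.
  by rewrite -[0 in LHS](addNr 0) -scaleN1r hP scaleN1r addNr.
have hZ m i a x : h (slot m i (a *: x)) = a *: h (slot m i x).
  by have := hP m i a x 0; rewrite h0 !addr0.
have E0 v : ext_rel v -> E v = 0.
  case=> [m i x y|m i a x|m i j ij mij]; rewrite ?raddfB /= ?linearZ /= !EE.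
  - by rewrite hD addrAC addrK subrr.
  - by rewrite hZ scalerN subrr.
  - exact: halt mij.
have [F FE] := mod_quot_lift E0; exists F => m.
by rewrite wedge.unlock FE EE.
Qed.

(** * Alternating expansion of wedge products *)

Section Wedge.
Variables (A : comNzRingType) (M : lmodType A) (p : nat).
Implicit Types (m : {ffun 'I_p -> M}) (x y : M).

Lemma wedge_linear m i a x y :
  wedge (slot m i (a *: x + y)) =
    a *: wedge (slot m i x) + wedge (slot m i y).
Proof.
have wD u v :
    wedge (slot m i (u + v)) = wedge (slot m i u) + wedge (slot m i v).
  apply/eqP; rewrite -subr_eq0 opprD addrA wedge.unlock -!raddfB /=.
  by apply/eqP/mod_class_gen/ExtD.
rewrite wD; congr (_ + _).
apply/eqP; rewrite -subr_eq0 wedge.unlock -linearZ -raddfB /=.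
by apply/eqP/mod_class_gen/ExtZ.
Qed.

Lemma wedge_alt m i j : i != j -> m i = m j -> wedge m = 0.
Proof.
by move=> ij mij; rewrite wedge.unlock; apply/mod_class_gen/ExtAlt/mij.
Qed.

Lemma wedge0 m i : wedge (slot m i 0) = 0.
Proof.
by rewrite -[0 in LHS](addNr 0) -scaleN1r wedge_linear scaleN1r addNr.
Qed.

(** Expand the vanishing wedge that has m i + m j in both slots i and j. *)
Lemma wedge_tperm m i j : i != j ->
  wedge [ffun l => m (tperm i j l)] = - wedge m.
Proof.
move=> ij; have ji : j != i by rewrite eq_sym.
pose s x y : {ffun 'I_p -> M} := slot (slot m i x) j y.
have sC x y : s x y = slot (slot m j y) i x.
  apply/ffunP=> l; rewrite !ffunE.
  by case: (eqVneq l j) => // ->; rewrite (negPf ji).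
have sxx x : wedge (s x x) = 0.
  by apply: (@wedge_alt _ i j) => //; rewrite !ffunE !eqxx (negPf ij).
have sDr x y z : wedge (s x (y + z)) = wedge (s x y) + wedge (s x z).
  by have := wedge_linear (slot m i x) j 1 y z; rewrite !scale1r.
have sDl x y z : wedge (s (y + z) x) = wedge (s y x) + wedge (s z x).
  by have := wedge_linear (slot m j x) i 1 y z; rewrite !sC !scale1r.
have -> : [ffun l => m (tperm i j l)] = s (m j) (m i).
  apply/ffunP=> l; rewrite !ffunE.
  case: tpermP => [->|->|/eqP/negPf-> /eqP/negPf->] //; rewrite ?eqxx //.
  by rewrite (negPf ij).
have -> : wedge m = wedge (s (m i) (m j)).
  congr wedge; apply/ffunP=> l; rewrite !ffunE.
  by case: eqP => [->|_] //; case: eqP => [->|].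
apply/eqP; rewrite -addr_eq0; apply/eqP.
have := sxx (m i + m j); rewrite sDr !sDl !sxx add0r addr0.
by rewrite addrC.
Qed.

Lemma wedge_perm m (s : 'S_p) :
  wedge [ffun l => m (s l)] = (-1) ^+ s *: wedge m.
Proof.
have [ts -> /=] := prod_tpermP s; elim: ts m => [|t ts IHts] m.
  move=> _; rewrite big_nil odd_perm1 scale1r; congr wedge.
  by apply/ffunP=> l; rewrite ffunE perm1.
move=> /andP[tN tsN]; rewrite big_cons odd_mul_tperm (tN : t.1 != t.2).
rewrite signr_addb expr1.
rewrite mulN1r scaleNr -IHts // -(wedge_tperm _ tN); congr wedge.
by apply/ffunP=> l; rewrite !ffunE permM.
Qed.

(** Both sides are multilinear in the rows of B, so the rows may be taken in
    the standard basis.  A row repeated makes both sides vanish, and otherwise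
    B is a permutation matrix. *)
Lemma wedge_det (B : 'M[A]_p) (v : 'I_p -> M) :
  wedge [ffun i => \sum_j B i j *: v j] = \det B *: wedge [ffun j => v j].
Proof.
pose c (r : 'rV[A]_p) : M := \sum_j r 0 j *: v j.
have cP a (x y : 'rV[A]_p) : c (a *: x + y) = a *: c x + c y.
  rewrite scaler_sumr -big_split; apply: eq_bigr => j _ /=.
  by rewrite !mxE scalerDl scalerA.
have c0 : c 0 = 0 by rewrite -[0 in LHS](addNr 0) -scaleN1r cP scaleN1r addNr.
have cdelta j : c (delta_mx 0 j) = v j.
  rewrite /c (bigD1 j) //= mxE !eqxx scale1r big1 ?addr0 // => l /negPf lj.
  by rewrite mxE lj andbF scale0r.
pose Q (m : {ffun 'I_p -> 'rV[A]_p}) := wedge [ffun i => c (m i)] =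
  \det (\matrix_l m l) *: wedge [ffun j => v j].
have cslot (m : {ffun 'I_p -> 'rV[A]_p}) i (x : 'rV[A]_p) :
    [ffun l => c (slot m i x l)] = slot [ffun l => c (m l)] i (c x).
  by apply/ffunP=> l; rewrite !ffunE; case: eqP.
suff: Q [ffun i => row i B].
  rewrite /Q; congr (_ = _ *: _); last first.
    by congr (\det _); apply/row_matrixP => i; rewrite rowK ffunE.
  congr wedge; apply/ffunP=> i; rewrite !ffunE.
  by apply: eq_bigr => j; rewrite mxE.
apply: (@multilinear_span_ind A _ p (fun r => exists j, r = delta_mx 0 j)).
- by move=> m i; rewrite /Q cslot c0 wedge0 det_slot0 scale0r.
- move=> m i a x y; rewrite /Q 3!cslot cP wedge_linear => -> ->.
  by rewrite det_slot scalerDl scalerA.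
- move=> m /choice[g mg]; rewrite /Q.
  have -> : [ffun i => c (m i)] = [ffun i => v (g i)].
    by apply/ffunP=> i; rewrite !ffunE mg cdelta.
  have [/injectiveP gI|/injectivePn[i [j ij gij]]] := boolP (injectiveb g).
    have -> : \matrix_l m l = perm_mx (perm gI).
      by apply/matrixP=> i j; rewrite !mxE mg mxE permE eqxx eq_sym.
    rewrite det_perm -wedge_perm; congr wedge.
    by apply/ffunP=> i; rewrite !ffunE permE.
  rewrite (@determinant_alternate _ _ _ i j) // => [|l]; last first.
    by rewrite !mxE !mg gij.
  by rewrite scale0r (@wedge_alt _ i j) // !ffunE gij.
- move=> i; rewrite ffunE [row i B]row_sum_delta.
  apply/asboolP => S [S0 SZD] Sgen; elim/big_ind: _ => // [x y Sx Sy|j _].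
    by rewrite -[x]scale1r; exact: SZD.
  by rewrite -[_ *: _]addr0; apply: SZD S0; apply: Sgen; exists j.
Qed.

End Wedge.

(** * Logarithmic derivations and differentials of Laurent polynomials *)

Section LaurentAlgebra.
Variables (k : fieldType) (n : nat).
Local Notation R := (laurent k n).
Implicit Types (f g u v : R) (a b : expo n) (c : k).
Local Notation mon := (@monomial k n).

Lemma laurent_span f : in_span (fun g : R => exists a, g = mon a) f.
Proof.
apply/asboolP=> S [S0 SZD] Sgen; rewrite (monalgE f).
elim/big_ind: _ => // [x y Sx Sy|a _]; first by rewrite -[x]scale1r; exact: SZD.
have -> : << f@_a *g a >> = f@_a *: mon a + 0.
  rewrite addr0; apply/malgP=> b; rewrite mcoeffZ !mcoeffU.
  by case: eqP; rewrite ?mulr1 ?mulr0.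
by apply: SZD S0; apply: Sgen; exists a.
Qed.

Lemma laurent_ind (P : R -> Prop) :
  P 0 -> (forall c f g, P f -> P g -> P (c *: f + g)) ->
  (forall a, P (mon a)) -> forall f, P f.
Proof.
move=> P0 PZD Pmon f.
by apply: (in_span_ind P0 PZD) (laurent_span f) => _ [a ->].
Qed.

Lemma monD a b : mon (a + b) = mon a * mon b.
Proof. by rewrite [RHS]lmulUU mulr1. Qed.

Lemma mon_prod (I : Type) (r : seq I) (F : I -> expo n) :
  \prod_(i <- r) mon (F i) = mon (\sum_(i <- r) F i).
Proof. by rewrite (big_morph mon monD (erefl (mon 0))). Qed.

Lemma mcoeff_mon a b : (mon a)@_b = (a == b)%:R.
Proof. exact: mcoeffU. Qed.

Fact logder_subproof j :
  {F : {linear R -> R} | forall a, F (mon a) = (a j)%:~R *: mon a}.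
Proof.
have [F FE] := @malg_lift k (expo n) R (fun a => (a j)%:~R *: mon a).
by exists F => a; rewrite FE scale1r.
Qed.

(** The derivation t_j d/dt_j; unlike d/dt_j it acts diagonally on monomials. *)
Definition logder j : {linear R -> R} := sval (logder_subproof j).

Lemma logder_mon j a : logder j (mon a) = (a j)%:~R *: mon a.
Proof. exact: (svalP (logder_subproof j)). Qed.

Lemma logderM j f g : logder j (f * g) = f * logder j g + g * logder j f.
Proof.
elim/laurent_ind: f => [|c f f' IH IH'|a].
- by rewrite mul0r linear0 mulr0 mul0r addr0.
- rewrite mulrDl linearP /= -scalerAl linearP /= IH IH' mulrDl mulrDr.
  by rewrite scalerDr -!scalerAl -!scalerAr addrACA.
elim/laurent_ind: g => [|c f f' IH IH'|b].
- by rewrite mulr0 linear0 mulr0 mul0r addr0.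
- rewrite mulrDr linearP /= -scalerAr linearP /= IH IH' mulrDl mulrDr.
  by rewrite scalerDr -!scalerAl -!scalerAr addrACA.
rewrite -monD !logder_mon ffunE rmorphD /= scalerDl -!scalerAr -!monD.
by rewrite [a + b]addrC [RHS]addrC [b + a]addrC.
Qed.

Definition jac (f : 'I_n -> R) : 'M[R]_n := \matrix_(i, j) logder j (f i).

Lemma kdD u v : kd (u + v) = kd u + kd v.
Proof.
apply/eqP; rewrite -subr_eq0 opprD addrA kd.unlock -!raddfB /=.
by apply/eqP/mod_class_gen/KaehlerD.
Qed.

Lemma kdZ c u : kd (c *: u) = (c%:A : R) *: kd u.
Proof.
apply/eqP; rewrite -subr_eq0 kd.unlock -linearZ -raddfB /=.
by apply/eqP/mod_class_gen/KaehlerZ.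
Qed.

Lemma kdM u v : kd (u * v) = u *: kd v + v *: kd u.
Proof.
apply/eqP; rewrite -subr_eq0 opprD addrA kd.unlock -!linearZ -!raddfB /=.
by apply/eqP/mod_class_gen/KaehlerM.
Qed.

(** The logarithmic differential t^-a d(t^a), additive in a by the Leibniz
    rule. *)
Definition dlog a : kaehler R := mon (- a) *: kd (mon a).

Lemma kd_mon a : kd (mon a) = mon a *: dlog a.
Proof. by rewrite scalerA -monD subrr scale1r. Qed.

Lemma dlogD : {morph dlog : a b / a + b}.
Proof.
move=> a b; rewrite /dlog monD kdM scalerDr !scalerA opprD !monD addrC.
congr (_ *: _ + _ *: _).
  by rewrite -mulrA -monD addNr mulr1.
by rewrite mulrAC -monD addNr mul1r.
Qed.

Definition unit_expo (j : 'I_n) : expo n := [ffun i => (i == j)%:Z].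

Fact dlogB : zmod_morphism dlog.
Proof. by move=> a b; apply/eqP; rewrite eq_sym subr_eq -dlogD subrK. Qed.

HB.instance Definition _ :=
  GRing.isZmodMorphism.Build (expo n) (kaehler R) dlog dlogB.

(** Exponents are integral combinations of unit vectors, and dlog is
    additive. *)
Lemma dlog_sum a : dlog a = \sum_j (a j)%:~R *: dlog (unit_expo j).
Proof.
have {1}-> : a = \sum_j unit_expo j *~ a j.
  apply/ffunP => i; rewrite sum_ffunE (bigD1 i) //= big1 => [|j /negPf ji].
    by rewrite addr0 ffunMzE ffunE eqxx intz.
  by rewrite ffunMzE ffunE eq_sym ji mul0rz.
by rewrite raddf_sum; apply: eq_bigr => j _; rewrite raddfMz scaler_int.
Qed.

Lemma kd_logder f : kd f = \sum_j logder j f *: dlog (unit_expo j).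
Proof.
elim/laurent_ind: f => [|c f g IHf IHg|a].
- rewrite big1 => [|j _]; last by rewrite linear0 scale0r.
  by rewrite -(scale0r 0) kdZ scale0r scale0r.
- rewrite kdD kdZ IHf IHg scaler_sumr -big_split; apply: eq_bigr => j _ /=.
  by rewrite linearP scalerDl scalerA -scalerAl mul1r.
rewrite kd_mon dlog_sum scaler_sumr; apply: eq_bigr => j _.
by rewrite logder_mon [LHS]scalerA; congr (_ *: _); rewrite mulrzr scaler_int.
Qed.

Lemma wedge_kd (f : 'I_n -> R) :
  wedge [ffun i => kd (f i)] =
    \det (jac f) *: wedge [ffun j => dlog (unit_expo j)].
Proof.
rewrite -wedge_det; congr wedge; apply/ffunP=> i; rewrite !ffunE kd_logder.
by apply: eq_bigr => j _; rewrite mxE.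
Qed.

Definition all_ones : expo n := [ffun=> 1].

(** Row i of the Jacobian is t^{c_i} times the integer vector c_i. *)
Lemma det_jac_mon (c : 'I_n -> expo n) :
  \det (jac (fun i => mon (c i))) =
    (\det (\matrix_(i, j) c i j))%:~R *: mon (\sum_i c i).
Proof.
pose D : 'rV[R]_n := \row_i mon (c i).
have -> : jac (fun i => mon (c i)) =
    diag_mx D *m map_mx intr (\matrix_(i, j) c i j).
  apply/matrixP=> i j; rewrite mul_diag_mx !mxE logder_mon.
  by rewrite mulrzr scaler_int.
rewrite det_mulmx det_diag det_map_mx /= mulrzr -scaler_int; congr (_ *: _).
by rewrite -mon_prod; apply: eq_bigr => i _; rewrite mxE.
Qed.

Lemma det_jac_var : \det (jac (@var k n)) = mon all_ones.
Proof.
have -> : @var k n = (fun i => mon (unit_expo i)) by [].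
rewrite det_jac_mon; have -> : \matrix_(i, j) unit_expo i j = 1%:M.
  by apply/matrixP=> i j; rewrite !mxE ffunE eq_sym natz.
rewrite det1 scale1r; congr mon; apply/ffunP=> i.
rewrite sum_ffunE (bigD1 i) //= big1 => [|j /negPf ji].
  by rewrite !ffunE eqxx addr0.
by rewrite ffunE eq_sym ji.
Qed.

End LaurentAlgebra.

Arguments logder {k n} j.
Arguments dlog {k n} a.
Arguments all_ones {n}.

(** * The residue as a Jacobian coefficient *)

Section ResidueFormula.
Variables (k : fieldType) (n : nat).
Local Notation R := (laurent k n).
Local Notation mon := (@monomial k n).

Fact kaehler_logder (j : 'I_n) :
  {F : {linear kaehler R -> R^o} | forall f : R, F (kd f) = logder j f}.
Proof.
apply: (@kaehler_lift k R R^o (logder j)) => [x y|c x|x y].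
- exact: linearD.
- by rewrite linearZ; exact: (esym (mulr_algl c (logder j x))).
- exact: logderM.
Qed.

(** This functional shows that the coefficient of a form on vol is unique: it
    maps vol to a monomial, hence to a unit. *)
Lemma jac_functional :
  {L : {linear forms k n -> R^o} |
    forall f0 f, L (diff_form f0 f) = f0 * \det (jac f)}.
Proof.
pose F j := sval (kaehler_logder j).
pose r (x : kaehler R) : 'rV[R]_n := \row_j F j x.
have rP a x y : r (a *: x + y) = a *: r x + r y.
  by apply/rowP=> j; rewrite !mxE [LHS]linearP.
pose h (m : {ffun 'I_n -> kaehler R}) : R^o :=
  \det (\matrix_i [ffun l => r (m l)] i).
have hslot m i x :
    h (slot m i x) = \det (\matrix_l slot [ffun l => r (m l)] i (r x) l).
  congr (\det _); apply/row_matrixP => l; rewrite !rowK !ffunE.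
  by case: eqP.
have [m i a x y|m i j ij mij|L LE] := @ext_lift _ _ _ _ h.
- by rewrite !hslot rP det_slot.
- rewrite /h (@determinant_alternate _ _ _ i j) // => l.
  by rewrite !mxE !ffunE mij.
exists L => f0 f; rewrite /diff_form [LHS]linearZ /= LE; congr (_ * _).
congr (\det _); apply/matrixP=> i j; rewrite !mxE !ffunE mxE.
exact: (svalP (kaehler_logder j)).
Qed.

Lemma mcoeffM_mon (f : R) a b : (f * mon a)@_b = f@_(b - a).
Proof.
elim/laurent_ind: f => [|c f g IHf IHg|d]; first by rewrite mul0r !mcoeff0.
  by rewrite mulrDl -scalerAl !mcoeffD !mcoeffZ IHf IHg.
by rewrite -monD !mcoeff_mon [in RHS]eq_sym subr_eq eq_sym.
Qed.

Lemma res_jac (f0 : R) (f : 'I_n -> R) :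
  res (diff_form f0 f) = (f0 * \det (jac f))@_0.
Proof.
have [L LE] := jac_functional.
set w := diff_form f0 f.
have wE : w = (f0 * \det (jac f) * mon (- all_ones)) *: vol k n.
  rewrite /w /diff_form /vol !wedge_kd det_jac_var !scalerA -!mulrA -monD.
  by rewrite addNr mulr1.
(* The existence shown in wE rules out the default value. *)
have topE : w = top_coef w *: vol k n.
  by rewrite /top_coef; case: xgetP => [h _ //|/(_ _ wE)].
have volE : L (vol k n) = mon all_ones.
  by rewrite -det_jac_var -[RHS]mul1r -LE /diff_form scale1r.
have : L w = top_coef w * mon all_ones.
  by rewrite {1}topE linearZ /= volE.
rewrite LE => ->; rewrite mcoeffM_mon sub0r /res; congr (_ @_ _).
by apply/ffunP=> i; rewrite !ffunE.
Qed.

Lemma res_mon (c0 : expo n) (c : 'I_n -> expo n) :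
  res (diff_form (mon c0) (fun p => mon (c p))) =
    (\det (\matrix_(i, j) c i j))%:~R * (c0 + \sum_p c p == 0)%:R.
Proof. by rewrite res_jac det_jac_mon -scalerAr -monD mcoeffZ mcoeff_mon. Qed.

End ResidueFormula.

(** * The projectors and the brackets *)

Section Operators.
Variables (k : fieldType) (n : nat).
Local Notation R := (laurent k n).
Local Notation mon := (@monomial k n).
Implicit Types (f x y : R) (a b : expo n) (j : 'I_n).

Lemma mcoeff_pplus j x b : (pplus j x)@_b = if 0 <= b j then x@_b else 0.
Proof.
rewrite /pplus raddf_sum -big_filter /=.
set A := [seq a <- _ | _].
have -> : \sum_(a <- A) (x@_a *: mon a)@_b = \sum_(a <- A | a == b) x@_b.
  rewrite [RHS]big_mkcond; apply: eq_bigr => a _.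
  by rewrite mcoeffZ mcoeff_mon; case: eqP => [->|_]; rewrite ?mulr1 ?mulr0.
rewrite big_const_seq -[count _ _]/(count_mem b _).
rewrite count_uniq_mem ?filter_uniq ?fset_uniq //.
rewrite mem_filter; case: (0 <= b j) => //=.
by case: msuppP => // _; rewrite /= addr0.
Qed.

Lemma mcoeff_proj j s x b :
  (proj j s x)@_b = if s == (0 <= b j) then x@_b else 0.
Proof.
case: s; first by rewrite mcoeff_pplus eq_sym eqb_id.
rewrite mcoeffB mcoeff_pplus eq_sym eqbF_neg.
by case: ifP => _; rewrite ?subrr ?subr0.
Qed.

Fact proj_is_linear j s : linear (proj (k := k) j s).
Proof.
move=> c x y; apply/malgP=> b; rewrite !(mcoeffD, mcoeffZ, mcoeff_proj).
by case: ifP => _ //; rewrite mulr0 addr0.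
Qed.

HB.instance Definition _ j s :=
  GRing.isLinear.Build k R R _ (proj (k := k) j s) (proj_is_linear j s).

Lemma proj_mon j s a :
  proj j s (mon a) = if s == (0 <= a j) then mon a else 0.
Proof.
apply/malgP=> b; rewrite mcoeff_proj.
have [<-|ab] := eqVneq a b; first by case: ifP; rewrite ?mcoeff0.
by do 2!case: ifP; rewrite ?mcoeff0 // mcoeff_mon (negPf ab).
Qed.

(** The bracket with f amounts to left composition with this operator. *)
Definition sandwich j s f x : R := proj j (~~ s) (f * proj j s x).

(** The term P_j^{-s} P_j^s g f of the commutator vanishes, the two
    projectors being complementary. *)
Lemma bracketE j s f (g : R -> R) x : bracket j s f g x = sandwich j s f (g x).
Proof.
rewrite /bracket /ad /= fctE /= raddfB /=.
rewrite [X in _ - X](_ : _ = 0) ?subr0 //.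
apply/malgP=> b; rewrite !mcoeff_proj mcoeff0.
by case: s; case: (0 <= b j).
Qed.

Lemma sandwich_linear j s f c x y :
  sandwich j s f (c *: x + y) = c *: sandwich j s f x + sandwich j s f y.
Proof. by rewrite /sandwich !linearP mulrDr -scalerAr linearP. Qed.

Lemma sandwich_linear_mul j s f f' c x :
  sandwich j s (c *: f + f') x = c *: sandwich j s f x + sandwich j s f' x.
Proof. by rewrite /sandwich mulrDl -scalerAl linearP. Qed.

(** Multiplication by t^a survives exactly when it moves the j-th exponent
    across zero, away from the side given by s. *)
Lemma sandwich_mon j s a b :
  sandwich j s (mon a) (mon b) =
  ((s == (0 <= b j)) && (s != (0 <= b j + a j)))%:R *: mon (a + b).
Proof.
rewrite /sandwich proj_mon; case: ifP => _ /=; last first.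
  by rewrite mulr0 linear0 scale0r.
rewrite -monD proj_mon ffunE [a j + _]addrC.
by case: s; case: (0 <= _) => /=; rewrite ?scale1r ?scale0r.
Qed.

Section Chain.
Variables (pi : 'S_n) (s : {ffun 'I_n -> bool}).

(** The composite over a list, so that inductions can peel off one factor at a
    time. *)
Definition chain (r : seq 'I_n) (f : 'I_n -> R) : R -> R :=
  \big[comp/id]_(j <- r) sandwich j (s j) (f (pi j)).

Lemma chain_cons j r (f : 'I_n -> R) x :
  chain (j :: r) f x = sandwich j (s j) (f (pi j)) (chain r f x).
Proof. by rewrite /chain big_cons. Qed.

Lemma big_bracketE r (f : 'I_n -> R) g x :
  (\big[comp/id]_(j <- r) bracket j (s j) (f (pi j))) g x = chain r f (g x).
Proof.
elim: r g => [|j r IHr] g; first by rewrite /chain !big_nil.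
by rewrite big_cons chain_cons /= bracketE IHr.
Qed.

Lemma chain_linear r (f : 'I_n -> R) c x y :
  chain r f (c *: x + y) = c *: chain r f x + chain r f y.
Proof.
elim: r => [|j r IHr]; first by rewrite /chain !big_nil.
by rewrite !chain_cons IHr sandwich_linear.
Qed.

Lemma eq_chain r (f f' : 'I_n -> R) x :
  {in r, forall j, f (pi j) = f' (pi j)} -> chain r f x = chain r f' x.
Proof.
by move=> ff'; rewrite /chain; congr (_ x); apply: eq_big_seq => j /ff'->.
Qed.

(** For a duplicate-free list the slot pi i is used by one factor only. *)
Lemma chain_slot r (m : {ffun 'I_n -> R}) i c f f' x : uniq r -> i \in r ->
  chain r (slot m (pi i) (c *: f + f')) x =
    c *: chain r (slot m (pi i) f) x + chain r (slot m (pi i) f') x.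
Proof.
elim: r => [|j r IHr] //= /andP[jr Ur]; rewrite inE !chain_cons.
have [->{i IHr} _|ij /= /(IHr Ur) {}IHr] := eqVneq i j.
  have slotr h : chain r (slot m (pi j) h) x = chain r m x.
    apply: eq_chain => l lr; rewrite ffunE (inj_eq perm_inj).
    by case: eqP lr jr => // -> ->.
  by rewrite !slotr !ffunE eqxx sandwich_linear_mul.
by rewrite !ffunE (inj_eq perm_inj) eq_sym (negPf ij) IHr sandwich_linear.
Qed.

End Chain.
End Operators.

(** * Traces of operators vanishing outside a finite set of monomials *)

Section Trace.
Variables (k : fieldType) (n : nat).
Local Notation R := (laurent k n).
Local Notation mon := (@monomial k n).
Implicit Types (a b : expo n) (j : 'I_n).

(** A trace witnessed by a finite set of monomials outside which phi vanishes.
    Such witnesses can be enlarged, which makes traces additive. *)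
Definition finite_trace (phi : R -> R) (v : k) : Prop :=
  linear phi /\ exists A : {fset expo n},
    (forall a, a \notin A -> phi (mon a) = 0) /\
    v = \sum_(a <- A) (phi (mon a))@_a.

Lemma finite_traceP phi v :
  finite_trace phi v -> finite_matrix phi /\ tr phi = v.
Proof.
move=> [phil [A [phi0 ->]]]; split; last first.
  by rewrite /tr (fsbigTE A) // => a /phi0->; rewrite mcoeff0.
split=> //.
pose supp := [seq (a, b) | a <- enum_fset A,
                           b <- enum_fset (msupp (phi (mon a)))].
apply: (sub_finite_set _ (finite_seq supp)) => -[a b] /= phiab.
apply/allpairsPdep; exists a, b; split; rewrite ?mcoeff_neq0 //.
  by apply: contraNT phiab => /phi0->; rewrite mcoeff0.
by rewrite -mcoeff_neq0.
Qed.

Lemma finite_trace0 phi : (forall x, phi x = 0) -> finite_trace phi 0.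
Proof.
move=> phi0; split=> [c x y|]; first by rewrite !phi0 scaler0 addr0.
by exists fset0; rewrite big_seq_fset0.
Qed.

Lemma finite_trace_linear c phi psi chi v w :
  finite_trace phi v -> finite_trace psi w ->
  (forall x, chi x = c *: phi x + psi x) -> finite_trace chi (c * v + w).
Proof.
move=> [phil [A [phi0 ->]]] [psil [B [psi0 ->]]] chiE; split.
  move=> d x y; rewrite !chiE phil psil !scalerDr !scalerA [c * d]mulrC.
  by rewrite [LHS]addrACA.
exists (A `|` B)%fset; split=> [a|].
  rewrite inE negb_or => /andP[/phi0 phia /psi0 psia].
  by rewrite chiE phia psia scaler0 addr0.
rewrite (big_fset_incl _ (fsubsetUl A B)) /=; last first.
  by move=> a _ /phi0->; rewrite mcoeff0.
rewrite [X in _ + X](big_fset_incl _ (fsubsetUr A B)) /=; last first.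
  by move=> a _ /psi0->; rewrite mcoeff0.
rewrite big_distrr -big_split; apply: eq_bigr => a _ /=.
by rewrite chiE mcoeffD mcoeffZ.
Qed.

End Trace.

(** * Sums of jumps of a step function *)

Section Jump.
Variable (k : fieldType).

(** The drop of the indicator function of the nonnegative integers between v
    and v + d. *)
Definition jump (v d : int) : k := (0 <= v)%R%:R - (0 <= v + d)%R%:R.

(** Summing over the sign s merges the two one-sided crossings of zero into a
    single signed one. *)
Lemma sum_sign_jump v d :
  \sum_(s : bool) (if s then 1 else -1) *
    ((s == (0 <= v)) && (s != (0 <= v + d)))%:R = jump v d.
Proof.
rewrite big_bool /jump; case: (0 <= v); case: (0 <= v + d) => /=;
  rewrite ?mulr0 ?mulr1 ?addr0 ?add0r ?subrr ?subr0 ?sub0r ?oppr0 //.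
Qed.

Lemma jump_out (N : nat) v d (x : int) :
  (`|v| <= N)%N -> (`|(v + d)%R| <= N)%N ->
  ~~ (- N%:Z <= x < N%:Z) -> jump (x + v) d = 0.
Proof.
move=> vN vdN xN; rewrite /jump.
have -> : (0 <= x + v) = (0 <= x + v + d) by apply/idP/idP; lia.
by rewrite subrr.
Qed.

Lemma sum_step (N : nat) v : (`|v| <= N)%N ->
  \sum_(i < N + N) (0 <= i%:Z - N%:Z + v)%R%:R = (N%:Z + v)%:~R :> k.
Proof.
move=> vN; have count m p : \sum_(i < p) (m <= i)%N%:R = (p - m)%N%:R :> k.
  elim: p => [|p IHp]; first by rewrite big_ord0.
  rewrite big_ord_recr /= IHp -natrD; congr (_%:R); case: leqP; lia.
(* The i-th term is 1 exactly from i = N - v on. *)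
pose m := `|N%:Z - v|%N.
rewrite (eq_bigr (fun i : 'I__ => (m <= i)%N%:R)) => [|i _]; last first.
  by congr (nat_of_bool _)%:R; apply/idP/idP; rewrite /m; lia.
rewrite count pmulrn; congr (_ *~ _); rewrite /m; lia.
Qed.

(** Telescoping: the window is wide enough to contain both steps, whose
    positions differ by d. *)
Lemma sum_jump (N : nat) v d : (`|v| <= N)%N -> (`|(v + d)%R| <= N)%N ->
  \sum_(i < N + N) jump (i%:Z - N%:Z + v) d = - d%:~R.
Proof.
move=> vN vdN; rewrite sumrB sum_step //.
under [X in _ - X]eq_bigr => i _ do rewrite -addrA.
by rewrite sum_step // -rmorphB -rmorphN /=; congr (_%:~R); lia.
Qed.
End Jump.

(** * The operator on monomials *)

Section Monomials.
Variables (k : fieldType) (n : nat).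
Local Notation R := (laurent k n).
Local Notation mon := (@monomial k n).
Implicit Types (a b : expo n) (j : 'I_n).

Definition box_point (N : nat) (g : {ffun 'I_n -> 'I_(N + N)}) : expo n :=
  [ffun j => (g j)%:Z - N%:Z].

(** The cube of exponents with all entries in [-N, N), parametrised by finite
    functions so that sums of products over it factor. *)
Definition box (N : nat) : {fset expo n} :=
  [fset a in codom (@box_point N)]%fset.

Lemma sum_box (N : nat) (F : expo n -> k) :
  \sum_(a <- box N) F a =
    \sum_(g : {ffun 'I_n -> 'I_(N + N)}) F (box_point g).
Proof.
rewrite -[RHS]big_enum -(big_map (@box_point N) xpredT) /=.
apply: perm_big; apply: uniq_perm => [||a]; rewrite ?fset_uniq ?inE //.
rewrite map_inj_uniq ?enum_uniq // => g h /ffunP gh.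
apply/ffunP=> j; apply/val_inj; move: (gh j); rewrite !ffunE /=; lia.
Qed.

Lemma notin_box (N : nat) a : a \notin box N ->
  exists j, ~~ (- N%:Z <= a j < N%:Z).
Proof.
move=> aN; apply/existsP; apply: contraNT aN; rewrite negb_exists.
move=> /forallP aN; rewrite !inE; apply/codomP.
have ltN j : (`|(a j + N%:Z)%R| < N + N)%N by move: (aN j); lia.
exists [ffun j => Ordinal (ltN j)]; apply/ffunP=> j; rewrite !ffunE /=.
move: (aN j); lia.
Qed.

(** When the factor j acts, its j-th exponent is b j shifted by the exponents
    of the factors already applied.  Only the independence of this shift u j
    from the signs s and from b matters, so its value is left existential. *)
Lemma chain_mon (pi : 'S_n) (c : 'I_n -> expo n) (r : seq 'I_n) : uniq r ->
  exists u : 'I_n -> int, forall s b,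
    chain pi s r (fun p => mon (c p)) (mon b) =
    (\prod_(j <- r) ((s j == (0 <= b j + u j)) &&
        (s j != (0 <= b j + u j + c (pi j) j)))%:R)
      *: mon (\sum_(j <- r) c (pi j) + b).
Proof.
elim: r => [|j r IHr] /= => [_|/andP[jr /IHr[u uE]]].
  by exists (fun=> 0) => s b; rewrite /chain !big_nil scale1r add0r.
(* The new factor acts last, hence after all of r. *)
pose u' l := if l == j then (\sum_(l <- r) c (pi l)) j else u l.
exists u' => s b; rewrite chain_cons uE !big_cons -[_ *: mon _]addr0.
rewrite sandwich_linear sandwich_mon scalerA.
rewrite [sandwich _ _ _ 0](_ : _ = 0); last first.
  by rewrite /sandwich linear0 mulr0 linear0.
rewrite addr0 addrA mulrC; congr (_ * _ *: _).
  by rewrite /u' eqxx ffunE [b j + _]addrC.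
apply: eq_big_seq => l lr; rewrite /u'; case: (l =P j) => // lj.
by rewrite lj (negPf jr) in lr.
Qed.

Lemma res_opE (f0 : R) (f : 'I_n -> R) x :
  res_op f0 f x = \sum_(pi : 'S_n) \sum_(s : {ffun 'I_n -> bool})
    ((-1) ^+ pi * \prod_j (if s j then 1 else -1)) *:
      chain pi s (index_enum 'I_n) f (f0 * x).
Proof.
rewrite /res_op fct_sumE; apply: eq_bigr => pi _.
rewrite fct_sumE; apply: eq_bigr => s _.
by rewrite -big_bracketE.
Qed.

(** The signed sum over all sign vectors is a product over j, by
    distributivity of scalars. *)
Lemma res_op_mon (c0 : expo n) (c : 'I_n -> expo n) :
  exists u : 'S_n -> 'I_n -> int, forall a,
    res_op (mon c0) (fun p => mon (c p)) (mon a) =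
    (\sum_(pi : 'S_n) (-1) ^+ pi *
      \prod_j jump k (a j + u pi j) (c (pi j) j)) *: mon (c0 + \sum_p c p + a).
Proof.
have /choice[u uE] (pi : 'S_n) := @chain_mon pi c _ (index_enum_uniq 'I_n).
exists (fun pi j => c0 j + u pi j) => a.
rewrite res_opE scaler_suml; apply: eq_bigr => pi _.
have cpi : \sum_j c (pi j) = \sum_p c p.
  by rewrite [RHS](reindex_inj (@perm_inj _ pi)).
under [LHS]eq_bigr => s _.
  rewrite -monD uE cpi scalerA -mulrA -big_split /=.
  over.
rewrite -scaler_suml -big_distrr /=; congr (_ *: mon _); last first.
  by rewrite addrA [_ + c0]addrC.
congr (_ * _); under [RHS]eq_bigr => j _ do rewrite -sum_sign_jump.
rewrite bigA_distr_bigA; apply: eq_bigr => s _; apply: eq_bigr => j _.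
by rewrite ffunE !addrA [c0 j + _]addrC.
Qed.

(** The diagonal vanishes unless the exponents cancel.  If they do, the sum over
    exponents of a product of jumps is the product over j of sums of jumps in
    one variable, that is of -c_{pi j, j}, and the sum over pi is a Leibniz
    expansion, up to (-1)^n. *)
Lemma finite_trace_mon (c0 : expo n) (c : 'I_n -> expo n) :
  finite_trace (res_op (mon c0) (fun p => mon (c p)))
    ((-1) ^+ n *
      ((\det (\matrix_(i, j) c i j))%:~R * (c0 + \sum_p c p == 0)%:R)).
Proof.
split.
  move=> d x y; rewrite !res_opE scaler_sumr -big_split.
  apply: eq_bigr => pi _ /=.
  rewrite scaler_sumr -big_split; apply: eq_bigr => s _ /=.
  by rewrite mulrDr -scalerAr chain_linear scalerDr !scalerA [d * _]mulrC.
have [u uE] := res_op_mon c0 c.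
(* N bounds both ends of every jump, so that the box contains them all. *)
pose v (p : 'S_n * 'I_n) :=
  maxn `|u p.1 p.2| `|(u p.1 p.2 + c (p.1 p.2) p.2)%R|.
pose N := (\max_p v p)%N.
have uN pi j : (`|u pi j| <= N)%N.
  by apply: leq_trans (leq_bigmax (pi, j)); rewrite /v /= leq_maxl.
have ucN pi j : (`|(u pi j + c (pi j) j)%R| <= N)%N.
  by apply: leq_trans (leq_bigmax (pi, j)); rewrite /v /= leq_maxr.
exists (box N); split=> [a /notin_box[j aj]|].
  rewrite uE big1 ?scale0r // => pi _.
  by rewrite (bigD1 j) //= (@jump_out k N) // mul0r mulr0.
under [RHS]eq_bigr => a _ do rewrite uE mcoeffZ mcoeff_mon -subr_eq0 addrK.
rewrite -big_distrl /= mulrA; congr (_ * _).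
rewrite sum_box exchange_big /= -det_tr rmorph_sum big_distrr.
apply: eq_bigr => pi _ /=.
rewrite -big_distrr /=.
under [X in _ = _ * X]eq_bigr => g _.
  under eq_bigr => j _ do rewrite ffunE.
  over.
rewrite -(bigA_distr_bigA (fun j (i : 'I_(N + N)) =>
  jump k (i%:Z - N%:Z + u pi j) (c (pi j) j))).
under [X in _ = _ * X]eq_bigr => j _ do rewrite sum_jump // -mulN1r.
rewrite big_split prodr_const card_ord /= mulrCA; congr (_ * _).
rewrite rmorphM rmorphXn rmorphN1 rmorph_prod; congr (_ * _).
by apply: eq_bigr => j _; rewrite !mxE.
Qed.

End Monomials.

(** * The trace by multilinearity *)

Section TraceFormula.
Variables (k : fieldType) (n : nat).
Local Notation R := (laurent k n).
Local Notation mon := (@monomial k n).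

Lemma res_op_linear_head c (f0 f0' : R) (f : 'I_n -> R) x :
  res_op (c *: f0 + f0') f x = c *: res_op f0 f x + res_op f0' f x.
Proof.
rewrite !res_opE scaler_sumr -big_split; apply: eq_bigr => pi _ /=.
rewrite scaler_sumr -big_split; apply: eq_bigr => s _ /=.
by rewrite mulrDl -scalerAl chain_linear scalerDr !scalerA [c * _]mulrC.
Qed.

Lemma res_op_slot (f0 : R) (m : {ffun 'I_n -> R}) i c f f' x :
  res_op f0 (slot m i (c *: f + f')) x =
    c *: res_op f0 (slot m i f) x + res_op f0 (slot m i f') x.
Proof.
rewrite !res_opE scaler_sumr -big_split; apply: eq_bigr => pi _ /=.
rewrite scaler_sumr -big_split; apply: eq_bigr => s _ /=.
rewrite -[i](permKV pi) chain_slot ?index_enum_uniq ?mem_index_enum //.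
by rewrite scalerDr !scalerA [c * _]mulrC.
Qed.

Lemma det_jac_slot (m : {ffun 'I_n -> R}) i c f f' :
  \det (jac (slot m i (c *: f + f'))) =
    c *: \det (jac (slot m i f)) + \det (jac (slot m i f')).
Proof.
pose r (g : R) : 'rV[R]_n := \row_j logder j g.
have jacE g : jac (slot m i g) = \matrix_l slot [ffun l => r (m l)] i (r g) l.
  apply/matrixP=> l j; rewrite !mxE !ffunE.
  by case: eqP => _; rewrite ?ffunE mxE.
rewrite !jacE -[_ *: \det _]mulr_algl -det_slot.
congr (\det _); apply/matrixP=> l j.
rewrite !mxE !ffunE; case: eqP => _ //.
by rewrite !mxE linearP /= mulr_algl.
Qed.

(** Both the operator and the Jacobian are linear in every argument, which
    leaves the case of monomials. *)
Lemma finite_trace_res_op (f0 : R) (f : 'I_n -> R) :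
  finite_trace (res_op f0 f) ((-1) ^+ n * (f0 * \det (jac f))@_0).
Proof.
have res_op0 g x : res_op 0 g x = 0 :> R.
  by rewrite -[0 in LHS](addNr 0) -scaleN1r res_op_linear_head scaleN1r addNr.
have -> : f = [ffun i => f i] :> ('I_n -> R).
  by apply: funext => i; rewrite ffunE.
elim/laurent_ind: f0 => [|c g0 h0 IHg IHh|c0].
- rewrite mul0r mcoeff0 mulr0; apply: finite_trace0 => x; exact: res_op0.
- rewrite mulrDl -scalerAl mcoeffD mcoeffZ mulrDr mulrCA.
  apply: finite_trace_linear IHg IHh _ => x; exact: res_op_linear_head.
pose Q (m : {ffun 'I_n -> R}) := finite_trace (res_op (mon c0) m)
  ((-1) ^+ n * (mon c0 * \det (jac m))@_0).
have Qlin m i c f1 f2 :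
    Q (slot m i f1) -> Q (slot m i f2) -> Q (slot m i (c *: f1 + f2)).
  move=> Q1 Q2; rewrite /Q det_jac_slot mulrDr -scalerAr.
  rewrite mcoeffD mcoeffZ mulrDr mulrCA.
  by apply: finite_trace_linear Q1 Q2 _ => x; exact: res_op_slot.
apply: (@multilinear_span_ind _ R n (fun g => exists a, g = mon a) Q _ Qlin).
- move=> m i; rewrite /Q.
  have -> : \det (jac (slot m i 0)) = 0.
    by rewrite -[0 in LHS](addNr 0) -scaleN1r det_jac_slot scaleN1r addNr.
  rewrite mulr0 mcoeff0 mulr0; apply: finite_trace0 => x.
  by rewrite -[0 in LHS](addNr 0) -scaleN1r res_op_slot scaleN1r addNr.
- move=> m /choice[c mc]; rewrite /Q.
  have -> : m = (fun p => mon (c p)) :> ('I_n -> R) by apply: funext.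
  rewrite det_jac_mon -scalerAr -monD mcoeffZ mcoeff_mon.
  exact: finite_trace_mon.
- by move=> i; exact: laurent_span.
Qed.

End TraceFormula.

(** Insert 1 = P^+ + P^- on the other side of f in both P^+ f and f P^+; the
    parts P^+ f P^+ cancel. *)
Lemma comm_pplusE (k : fieldType) (f0 f1 : laurent k 1) x :
  (((proj (k := k) (ord0 : 'I_1) true \o mulop f1) -
    (mulop f1 \o proj (k := k) ord0 true)) \o mulop f0) x =
  - res_op f0 (fun=> f1) x.
Proof.
rewrite res_opE (big_pred1 1%g) => [|s]; last by rewrite /= [s]permS1 eqxx.
pose const_sign (b : bool) : {ffun 'I_1 -> bool} := [ffun=> b].
rewrite (reindex const_sign) /=; last first.
  exists (fun s => s ord0) => s _; first by rewrite ffunE.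
  by apply/ffunP=> i; rewrite ffunE (ord1 i).
have chainE s y : chain 1%g s (index_enum 'I_1) (fun=> f1) y =
    sandwich ord0 (s ord0) f1 y.
  by rewrite /chain big_ord_recl big_ord0.
rewrite big_bool !chainE odd_perm1 !big_ord1 !ffunE !mul1r scale1r scaleN1r.
set y := f0 * x; pose P := proj (k := k) (ord0 : 'I_1) true.
pose P' := proj (k := k) (ord0 : 'I_1) false.
have projD (z : laurent k 1) : P z + P' z = z by rewrite addrC subrK.
have PD : {morph P : u v / u + v} by exact: (linearD (proj ord0 true)).
change (P (f1 * y) - f1 * P y = - (P' (f1 * P y) - P (f1 * P' y))).
rewrite -{1}(projD y) -[f1 * P y in LHS]projD mulrDr PD.
by rewrite opprB opprD [LHS]addrACA subrr add0r.
Qed.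

Theorem theorem4 (k : fieldType) :
  (forall (n : nat) (hn : (0 < n)%N)
      (f0 : laurent k n) (f : 'I_n -> laurent k n),
    finite_matrix (res_op f0 f) /\
    res (diff_form f0 f) = (-1) ^+ n * tr (res_op f0 f)) /\
  (forall f0 f1 : laurent k 1,
    let pi := proj (k := k) (ord0 : 'I_1) true in
    let comm := (pi \o mulop f1) - (mulop f1 \o pi) in
    finite_matrix (comm \o mulop f0) /\
    res (diff_form f0 (fun=> f1)) = tr (comm \o mulop f0)) /\
  (forall (n : nat) (hn : (0 < n)%N) (c0 : expo n) (c : 'I_n -> expo n),
    let w := diff_form (monomial k c0) (fun p => monomial k (c p)) in
    ((forall i : 'I_n, c0 i + \sum_(p < n) c p i = 0) ->
      res w = (\det (\matrix_(i < n, p < n) c p i))%:~R) /\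
    (~ (forall i : 'I_n, c0 i + \sum_(p < n) c p i = 0) -> res w = 0)) /\
  (forall (alpha : k) (c1 : int),
    res (diff_form (alpha *: (monomial k [ffun=> c1] : laurent k 1))
           (fun=> var k ord0)) =
      if c1 == -1 then alpha else 0).
Proof.
split=> [n _ f0 f|].
  have [fin ->] := finite_traceP (finite_trace_res_op f0 f); split=> //.
  by rewrite res_jac signrMK.
split=> [f0 f1 pi comm|].
  have commT : finite_trace (comm \o mulop f0) (f0 * \det (jac (fun=> f1)))@_0.
    have -> : (f0 * \det (jac (fun=> f1)))@_0 =
        -1 * ((-1) ^+ 1 * (f0 * \det (jac (fun=> f1)))@_0) + 0.
      by rewrite addr0 mulrA mulrNN !mul1r.
    apply: (finite_trace_linear (finite_trace_res_op f0 (fun=> f1))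
      (finite_trace0 (phi := fun=> 0) _)) => // x.
    by rewrite addr0 scaleN1r; exact: comm_pplusE.
  by have [fin ->] := finite_traceP commT; split=> //; rewrite res_jac.
split=> [n _ c0 c w|alpha c1].
  have -> : res w = (\det (\matrix_(i < n, p < n) c p i))%:~R *
      (c0 + \sum_p c p == 0)%:R.
    rewrite [LHS]res_mon -det_tr; congr ((\det _)%:~R * _).
    by apply/matrixP=> i j; rewrite !mxE.
  have sum0P : reflect (forall i, c0 i + \sum_(p < n) c p i = 0)
      (c0 + \sum_p c p == 0).
    apply: (iffP eqP) => [/ffunP sum0 i|sum0].
      by move: (sum0 i); rewrite !ffunE sum_ffunE.
    by apply/ffunP=> i; rewrite !ffunE sum_ffunE.
  by case: sum0P => sum0; split=> // _; rewrite ?mulr1 ?mulr0.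
rewrite res_jac -scalerAl mcoeffZ -(res_jac _ (fun=> var k ord0)).
rewrite [X in _ * X](@res_mon k 1 [ffun=> c1] (fun=> unit_expo ord0)).
rewrite det_mx11 mxE ffunE eqxx mul1r.
have -> : ([ffun=> c1] + \sum_(p < 1) unit_expo ord0 == 0 :> expo 1) =
    (c1 == -1).
  rewrite big_ord1; apply/eqP/eqP => [/ffunP/(_ ord0)|->].
    by rewrite !ffunE eqxx; lia.
  by apply/ffunP=> i; rewrite !ffunE (ord1 i).
by case: eqP; rewrite ?mulr1 ?mulr0.
Qed.
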